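(* Let $M$ be a Coxeter matrix on $S$ with $m_{st}\in\{2,3,\infty\}$ for all $s,t\in S$, $s\neq t$, whose defining graph is connected. Let $\Delta$ be a locally finite building of type $M$, and let $\Gamma<\mathrm{Aut}(\Delta)$ be a Singer cyclic lattice in $\Delta$ of order $q\geq 2$. Let $\mathcal{M}=\mathcal{M}(\Gamma)$ be a gluing matrix associated to $\Gamma$. Then there exists an isomorphism of Weyl graphs $\omega:\Gamma\backslash\Delta\to\mathcal{W}_{\mathcal{M}}$.
   Context: **Defining graph.** The defining graph $L$ of $M$ is the simplicial graph with vertex set $S$ and edges the pairs $\{s,t\}$, $s\ne t$, with $m_{st}<\infty$. An orientation $\bar E\subseteq S\times S$ of $L$ contains exactly one of $(s,t),(t,s)$ for each edge $\{s,t\}$ of $L$, and nothing else. **Weyl graphs (with setoid panel groupoids), homotopy.** The Weyl graphs used here are given by the following data: a set of chambers; for each $s\in S$ the panel groupoid of type $s$, which is the connected setoid on the chambers (exactly one morphism $x\xrightarrow{s}y$ for each ordered pair of chambers; those with $x\neq y$ are the edges of type $s$); and for $s\neq t$ with $m_{st}<\infty$ a set of closed galleries of type $stst\cdots$ ($2m_{st}$ letters), called defining suites. A gallery is a finite composable sequence of edges. The fundamental groupoid is the groupoid with objects the chambers that is freely generated by the panel groupoids subject to the relations that the composite of the edges of each defining suite is an identity. Galleries are homotopic if their composites in the fundamental groupoid agree. An isomorphism of such Weyl graphs (over the same $S$) is a bijection $\omega$ of chambers, acting on edges by $(x\xrightarrow{s}y)\mapsto(\omega(x)\xrightarrow{s}\omega(y))$,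 such that two galleries are homotopic iff their images are. The $\{s,t\}$-residue of such a Weyl graph is the Weyl graph over $\{s,t\}$ with the same chambers, the panel groupoids of types $s$ and $t$, and the defining suites for $\{s,t\}$. **Singer lattices and quotients.** A group action on a building (by type-preserving automorphisms) is panel-regular if for each $s\in S$ it is free and transitive on the set of $s$-panels. The quotient $G\backslash\Delta$ of a building by a panel-regular action is the Weyl graph with chambers the $G$-orbits of chambers, connected setoids as panel groupoids (each edge being an orbit of edges $C\xrightarrow{s}D$, $C\sim_sD$, $C\ne D$), and defining suites the images of all closed galleries of type $stst\cdots$ ($2m_{st}$ letters) in $\Delta$, for $s\ne t$ with $m_{st}<\infty$. A Singer lattice of order $q$ ($q$ finite) is a subgroup of $\mathrm{Aut}(\Delta)$ acting panel-regularly on $\Delta$ such that the quotient has $q+1$ chambers. It is a Singer cyclic lattice if the stabilizer of every spherical $2$-residue (every $\{s,t\}$-residue with $s\neq t$, $m_{st}<\infty$) is cyclic. **Difference sets, standard digons and triangles.** Let $k=q+1$, $\delta=q^2+q+1$, $\mathcal{C}=\mathbb{Z}/k\mathbb{Z}$, $\mathcal{C}^{\ast}=\{1,\dots,q\}\subset\mathcal{C}$. A difference set of order $q$ is a subset $\mathcal{D}\subset\mathbb{Z}/\delta\mathbb{Z}$ with $|\mathcal{D}|=q+1$ such that $(x,y)\mapsto x-y$ restricts to a bijection from pairs of distinct elements of $\mathcal{D}$ onto the non-zero elements of $\mathbb{Z}/\delta\mathbb{Z}$. It is based if $0\in\mathcal{D}$; then $\mathcal{D}^{\ast}=\mathcal{D}\setminus\{0\}$.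 The Weyl graph $k\backslash\mathbf{D}(q)$ over $\{s,t\}$ with $m_{st}=2$ has chambers $\mathbb{Z}/k\mathbb{Z}$ and defining suites $[0\xrightarrow{s}y\xrightarrow{t}z\xrightarrow{s}(z-y)\xrightarrow{t}0]$ with $0\ne y$, $y\neq z$. For a based difference set $\mathcal{D}$ of order $q$, the Weyl graph $\delta\backslash\mathcal{T}(\mathcal{D})$ over $\{s,t\}$ with $m_{st}=3$ has chambers $\mathcal{D}$ and defining suites $[0\xrightarrow{s}x\xrightarrow{t}y\xrightarrow{s}z\xrightarrow{t}y'\xrightarrow{s}x'\xrightarrow{t}0]$ with $x,y,z,x',y'\in\mathcal{D}$, $0\ne x$, $x\ne y$, $y\ne z$, $y'-x'=x-y+z$ in $\mathbb{Z}/\delta\mathbb{Z}$. **Gluing matrices and $\mathcal{W}_{\mathcal{M}}$.** A gluing matrix of type $M$ and order $q\ge2$ is a map $\mathcal{M}:\mathcal{C}^{\ast}\times\bar E\to\mathbb{Z}_{\ge1}$ such that for each $(s,t)\in\bar E$ the map $n\mapsto\mathcal{M}(n,(s,t))$ is: if $m_{st}=2$, a permutation of $\mathcal{C}^{\ast}$; if $m_{st}=3$, a bijection from $\mathcal{C}^{\ast}$ onto $\mathcal{D}^{\ast}$ for some based difference set $\mathcal{D}=\mathcal{D}_{st}$ of order $q$ (elements represented by integers in $\{1,\dots,\delta-1\}$). The Weyl graph $\mathcal{W}_{\mathcal{M}}$ over $S$ has chambers $\mathcal{C}$; for $(s,t)\in\bar E$ let $\Omega_{st}(0)=0$, $\Omega_{st}(x)=\mathcal{M}(x,(s,t))$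 for $x\neq0$, a bijection from $\mathcal{C}$ onto the chambers of $k\backslash\mathbf{D}(q)$ if $m_{st}=2$, resp. of $\delta\backslash\mathcal{T}(\mathcal{D}_{st})$ if $m_{st}=3$; the defining suites of $\mathcal{W}_{\mathcal{M}}$ for $\{s,t\}$ are the $\Omega_{st}$-preimages of the defining suites of that target. **Gluing matrix associated to $\Gamma$.** Choose an orientation $\bar E$ of $L$ and a bijection from the chambers of $\Gamma\backslash\Delta$ to $\mathcal{C}$, and use it to identify the two sets. For each $(s,t)\in\bar E$ with $m_{st}=2$ choose a permutation $\mathcal{C}\to\mathcal{C}$ with $0\mapsto0$ that is an isomorphism from the $\{s,t\}$-residue of $\Gamma\backslash\Delta$ to $k\backslash\mathbf{D}(q)$; for each $(s,t)\in\bar E$ with $m_{st}=3$ choose a based difference set $\mathcal{D}$ of order $q$ and a bijection $\mathcal{C}\to\mathcal{D}$ with $0\mapsto0$ that is an isomorphism from the $\{s,t\}$-residue of $\Gamma\backslash\Delta$ to $\delta\backslash\mathcal{T}(\mathcal{D})$ (such choices exist). Let $\mathcal{M}(-,(s,t))$ be the restriction of the chosen bijection to $\mathcal{C}^{\ast}$. Any $\mathcal{M}$ so obtained is a gluing matrix associated to $\Gamma$. *)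

(* Defs.v *)
From mathcomp Require Import all_boot all_order all_algebra.
From mathcomp Require Import boolp classical_sets functions cardinality.
From Stdlib Require Import Relation_Operators.
From Stdlib Require List.

Set Implicit Arguments.
Unset Strict Implicit.
Unset Printing Implicit Defensive.

Import GRing.Theory.
Local Open Scope classical_set_scope.

(* For R an equivalence relation, R x is the class of x. *)
Definition quot (T : Type) (R : T -> T -> Prop) : Type :=
  {A : set T | exists x, A = R x}.

Definition cls (T : Type) (R : T -> T -> Prop) (x : T) : quot R :=
  exist _ (R x) (ex_intro _ x erefl).

(* [None] stands for the entry oo. *)
Record coxeter_matrix (S : Type) := CoxeterMatrix {
  cox_entry :> S -> S -> option nat;
  cox_diag : forall s, cox_entry s s = Some 1;
  cox_sym : forall s t, cox_entry s t = cox_entry t s;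
  cox_offdiag : forall s t n, s <> t -> cox_entry s t = Some n -> 2 <= n }.

Definition defining_edge (S : Type) (M : coxeter_matrix S) (s t : S) : Prop :=
  s <> t /\ M s t <> None.

Definition defining_graph_connected (S : Type) (M : coxeter_matrix S) : Prop :=
  forall s t, clos_refl_trans S (defining_edge M) s t.

Definition orientation (S : Type) (M : coxeter_matrix S) (E : S -> S -> Prop)
    : Prop :=
  [/\ forall s t, E s t -> defining_edge M s t,
      forall s t, defining_edge M s t -> E s t \/ E t s
    & forall s t, ~ (E s t /\ E t s)].

Fixpoint alt (S : Type) (s t : S) (n : nat) : seq S :=
  if n is n'.+1 then s :: alt t s n' else [::].

(* Words over S modulo (st)^m_st = 1. As m_ss = 1 gives s^2 = 1, every word is
   invertible, so the monoid presented here is the Coxeter group. *)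
Inductive cox_eq (S : Type) (M : coxeter_matrix S) : seq S -> seq S -> Prop :=
| cox_refl w : cox_eq M w w
| cox_symm v w : cox_eq M v w -> cox_eq M w v
| cox_trans u v w : cox_eq M u v -> cox_eq M v w -> cox_eq M u w
| cox_cat v v' w w' :
    cox_eq M v v' -> cox_eq M w w' -> cox_eq M (v ++ w) (v' ++ w')
| cox_rel s t m : M s t = Some m -> cox_eq M (alt s t (2 * m)) [::].

Definition coxeter_group (S : Type) (M : coxeter_matrix S) : Type :=
  quot (cox_eq M).

Definition reduced (S : Type) (M : coxeter_matrix S) (f : seq S) : Prop :=
  forall g, cox_eq M f g -> size f <= size g.

(* A path starting at x is encoded by the list of pairs (type, next chamber). *)
Definition gend (S C : Type) (x : C) (p : seq (S * C)) : C :=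
  last x (map snd p).

Definition gtype (S C : Type) (p : seq (S * C)) : seq S := map fst p.

Definition gmap (S C C' : Type) (f : C -> C') (p : seq (S * C)) :
    seq (S * C') := map (fun e => (e.1, f e.2)) p.

Fixpoint gallery (S C : Type) (R : S -> C -> C -> Prop) (x : C)
    (p : seq (S * C)) : Prop :=
  if p is (s, y) :: p' then [/\ R s x y, x <> y & gallery R y p'] else True.

Record chamber_system (S : Type) := ChamberSystem {
  cs_chamber :> Type;
  cs_adj : S -> cs_chamber -> cs_chamber -> Prop;
  cs_refl : forall s C, cs_adj s C C;
  cs_symm : forall s C D, cs_adj s C D -> cs_adj s D C;
  cs_trans : forall s C D F, cs_adj s C D -> cs_adj s D F -> cs_adj s C F }.

Definition panel (S : Type) (X : chamber_system S) (s : S) (C : X) : set X :=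
  cs_adj s C.

Definition locally_finite (S : Type) (X : chamber_system S) : Prop :=
  forall (s : S) (C : X), finite_set (panel s C).

(* Buildings as chamber systems with a W-valued distance (Tits, Ronan). *)
Definition is_building (S : Type) (M : coxeter_matrix S)
    (X : chamber_system S) : Prop :=
  (forall (s : S) (C : X), exists D, cs_adj s C D /\ C <> D) /\
  exists dist : X -> X -> coxeter_group M,
    forall (f : seq S) (C D : X), reduced M f ->
      (dist C D = cls (cox_eq M) f <->
       exists p, [/\ gallery (@cs_adj S X) C p, gtype p = f & gend C p = D]).

Definition residue2 (S : Type) (X : chamber_system S) (s t : S) (C : X) :
    set X :=
  [set D | exists p, [/\ gallery (@cs_adj S X) C p,
                         List.Forall [set s; t] (gtype p) & gend C p = D]].

Definition automorphism (S : Type) (X : chamber_system S) (g : X -> X) : Prop :=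
  bijective g /\ forall s C D, cs_adj s C D <-> cs_adj s (g C) (g D).

Record aut_subgroup (S : Type) (X : chamber_system S) := AutSubgroup {
  as_set :> (X -> X) -> Prop;
  as_aut : forall g, as_set g -> automorphism g;
  as_one : as_set id;
  as_mul : forall g h, as_set g -> as_set h -> as_set (g \o h);
  as_inv : forall g, as_set g ->
    exists h, [/\ as_set h, cancel g h & cancel h g] }.

Definition same_orbit (S : Type) (X : chamber_system S) (G : aut_subgroup X)
    (C D : X) : Prop := exists2 g, G g & g C = D.

Record panel_regular (S : Type) (X : chamber_system S) (G : aut_subgroup X)
    : Prop := PanelRegular {
  pr_free : forall (s : S) (C : X) g,
    G g -> g @` panel s C = panel s C -> forall D, g D = D;
  pr_transitive : forall (s : S) (C D : X),
    exists2 g, G g & g @` panel s C = panel s D }.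

Definition stabilizer (S : Type) (X : chamber_system S) (G : aut_subgroup X)
    (A : set X) : set (X -> X) := [set g | G g /\ g @` A = A].

(* Every h is g^n or g^-n. *)
Definition cyclic_perms (T : Type) (H : set (T -> T)) : Prop :=
  exists2 g, H g & forall h, H h ->
    exists n : nat, h =1 iter n g \/ h \o iter n g =1 id.

(* Weyl graphs over J, a subset of S, with connected setoids as panel
   groupoids; [suite s t x p] says that the path p starting at x is a defining
   suite of type stst... . A Weyl graph over S is one over [setT]. *)
Record weyl_graph (S : Type) (M : coxeter_matrix S) (J : set S) := WeylGraph {
  chamber : Type;
  suite : S -> S -> chamber -> seq (S * chamber) -> Prop;
  suiteP : forall s t x p, suite s t x p ->
    [/\ s <> t, exists2 m, M s t = Some m & gtype p = alt s t (2 * m),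
        gallery (fun u _ _ => J u) x p & gend x p = x] }.

Definition wgallery (S : Type) (M : coxeter_matrix S) (J : set S)
    (W : weyl_graph M J) (x : chamber W) (p : seq (S * chamber W)) : Prop :=
  gallery (fun u _ _ => J u) x p.

(* Equality in the fundamental groupoid: a morphism with source x is written as
   a composable sequence of morphisms of panel groupoids, here possibly
   identities, and two such words are identified by composing within a panel
   groupoid and by the defining suites. *)
Inductive fgroupoid_eq (S : Type) (M : coxeter_matrix S) (J : set S)
    (W : weyl_graph M J) :
    chamber W -> seq (S * chamber W) -> seq (S * chamber W) -> Prop :=
| fg_refl x p : List.Forall J (gtype p) -> fgroupoid_eq x p p
| fg_symm x p p' : fgroupoid_eq x p p' -> fgroupoid_eq x p' p
| fg_trans x p p' p'' :
    fgroupoid_eq x p p' -> fgroupoid_eq x p' p'' -> fgroupoid_eq x p p''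
| fg_cat x p p' r r' :
    fgroupoid_eq x p p' -> fgroupoid_eq (gend x p) r r' ->
    fgroupoid_eq x (p ++ r) (p' ++ r')
| fg_id x s : J s -> fgroupoid_eq x [:: (s, x)] [::]
| fg_comp x y z s : J s -> fgroupoid_eq x [:: (s, y); (s, z)] [:: (s, z)]
| fg_suite x p s t : suite s t x p -> fgroupoid_eq x p [::].

Definition homotopic (S : Type) (M : coxeter_matrix S) (J : set S)
    (W : weyl_graph M J) (x : chamber W) (p : seq (S * chamber W))
    (y : chamber W) (r : seq (S * chamber W)) : Prop :=
  x = y /\ fgroupoid_eq x p r.

Definition weyl_iso (S : Type) (M : coxeter_matrix S) (J : set S)
    (W W' : weyl_graph M J) (w : chamber W -> chamber W') : Prop :=
  bijective w /\
  forall x p y r, wgallery x p -> wgallery y r ->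
    (homotopic x p y r <-> homotopic (w x) (gmap w p) (w y) (gmap w r)).

Definition residue_suite (S : Type) (M : coxeter_matrix S)
    (W : weyl_graph M setT) (s t u v : S) (x : chamber W)
    (p : seq (S * chamber W)) : Prop :=
  [/\ [set s; t] u, [set s; t] v & suite u v x p].

Lemma residue_suiteP (S : Type) (M : coxeter_matrix S)
    (W : weyl_graph M setT) (s t u v : S) (x : chamber W) p :
    residue_suite s t u v x p ->
  [/\ u <> v, exists2 m, M u v = Some m & gtype p = alt u v (2 * m),
      gallery (fun a _ _ => [set s; t] a) x p & gend x p = x].
Proof.
case=> Ju Jv sp; have [uv [m Mm tp] gp ep] := suiteP sp.
split => //; first by exists m.
move: (2 * m) tp gp => n {sp uv Mm ep}.
elim: n u v Ju Jv x p => [|n IH] u v Ju Jv x [|[a y] p] //=.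
by case=> -> tp [_ xy gp]; split => //; apply: (IH v u).
Qed.

Definition residue (S : Type) (M : coxeter_matrix S) (W : weyl_graph M setT)
    (s t : S) : weyl_graph M [set s; t] :=
  @WeylGraph S M [set s; t] (chamber W) (@residue_suite S M W s t)
    (@residue_suiteP S M W s t).

Definition orbits (S : Type) (X : chamber_system S) (G : aut_subgroup X)
    : Type := quot (same_orbit G).

Definition orbit_of (S : Type) (X : chamber_system S) (G : aut_subgroup X)
    (C : X) : orbits G := cls (same_orbit G) C.

Definition quotient_suite (S : Type) (M : coxeter_matrix S)
    (X : chamber_system S) (G : aut_subgroup X) (s t : S) (x : orbits G)
    (p : seq (S * orbits G)) : Prop :=
  s <> t /\ exists m C r,
    [/\ M s t = Some m, gallery (@cs_adj S X) C r, gtype r = alt s t (2 * m),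
        gend C r = C & x = orbit_of G C /\ p = gmap (orbit_of G) r].

Lemma quotient_suiteP (S : Type) (M : coxeter_matrix S) (X : chamber_system S)
    (G : aut_subgroup X) (hG : panel_regular G) (s t : S) (x : orbits G) p :
    quotient_suite M s t x p ->
  [/\ s <> t, exists2 m, M s t = Some m & gtype p = alt s t (2 * m),
      gallery (fun u _ _ => setT u) x p & gend x p = x].
Proof.
case=> st [m [C [r [Mm gr tr er [-> ->]]]]]; split => //.
- by exists m => //; rewrite -tr /gtype /gmap -map_comp.
- elim: r C gr {tr er} => [|[u D] r IH] C //= [CD nCD gr].
  split=> //; last exact: IH.
  move=> /(congr1 (fun A => sval A D)) /= E.
  have : same_orbit G D D by exists id => //; exact: as_one.
  rewrite -E => -[g Gg gC]; apply: nCD; rewrite -gC.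
  have [[h gh hg] gadj] := as_aut Gg.
  rewrite (pr_free hG (s := u) (C := C) Gg) //; apply/seteqP; split => y /=.
    case=> z Cz <-; apply: (cs_trans CD); rewrite -gC.
    exact: (proj1 (gadj _ _ _) Cz).
  move=> Cy; exists (h y) => //; apply/gadj; rewrite hg gC.
  exact: cs_trans (cs_symm CD) Cy.
- rewrite -[in RHS]er /gend /gmap -map_comp.
  by rewrite -(last_map (orbit_of G)) -map_comp.
Qed.

Definition quotient_weyl_graph (S : Type) (M : coxeter_matrix S)
    (X : chamber_system S) (G : aut_subgroup X) (hG : panel_regular G) : weyl_graph M setT :=
  @WeylGraph S M setT (orbits G) (@quotient_suite S M X G)
    (@quotient_suiteP S M X G hG).

Record singer_lattice (S : Type) (M : coxeter_matrix S) (X : chamber_system S)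
    (q : nat) (G : aut_subgroup X) : Prop := SingerLattice {
  sl_regular : panel_regular G;
  sl_order : exists f : 'I_q.+1 -> chamber (quotient_weyl_graph M sl_regular),
    bijective f }.

Record singer_cyclic_lattice (S : Type) (M : coxeter_matrix S)
    (X : chamber_system S) (q : nat) (G : aut_subgroup X) : Prop :=
  SingerCyclicLattice {
  scl_singer : singer_lattice M q G;
  scl_cyclic : forall (s t : S) (C : X), s <> t -> M s t <> None ->
    cyclic_perms (stabilizer G (residue2 s t C)) }.

(* Z/nZ is the canonical zmodType on 'I_n, for n a successor. *)
Notation Zk q := 'I_q.+1.
Notation Zdelta q := 'I_(q ^ 2 + q).+1.

Local Open Scope ring_scope.

Definition difference_set (q : nat) (D : {set Zdelta q}) : Prop :=
  #|D| = q.+1 /\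
  set_bij [set xy : Zdelta q * Zdelta q |
             [/\ xy.1 \in D, xy.2 \in D & xy.1 <> xy.2]]
          [set d : Zdelta q | d <> 0]
          (fun xy => xy.1 - xy.2).

Record based_difference_set (q : nat) := BasedDifferenceSet {
  bds_set :> {set Zdelta q};
  bds_diff : difference_set bds_set;
  bds_based : 0 \in bds_set }.

Definition digon_suite (S : Type) (q : nat) (s t : S) (x0 : Zk q)
    (p : seq (S * Zk q)) : Prop :=
  x0 = 0 /\ exists y z : Zk q, [/\ y <> 0, y <> z &
    p = [:: (s, y); (t, z); (s, z - y); (t, 0)]].

Definition triangle_suite (S : Type) (q : nat) (s t : S) (x0 : Zdelta q)
    (p : seq (S * Zdelta q)) : Prop :=
  x0 = 0 /\ exists x y z x' y' : Zdelta q,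
    [/\ x <> 0, x <> y, y <> z, y' - x' = x - y + z &
      p = [:: (s, x); (t, y); (s, z); (t, y'); (s, x'); (t, 0)]].

Lemma digon_gallery (S : Type) (q : nat) (s t : S) (J : set S) (x : Zk q) p :
    J s -> J t -> digon_suite s t x p ->
  [/\ gtype p = alt s t (2 * 2), gallery (fun u _ _ => J u) x p
    & gend x p = x].
Proof.
move=> Js Jt [-> [y [z [y0 yz ->]]]]; split => //=; split=> //; first exact/nesym.
split=> //; split=> //.
  by move/(congr1 (fun a => - z + a)); rewrite addrA addNr add0r => /esym/eqP;
     rewrite oppr_eq0 => /eqP.
by split=> // /eqP; rewrite subr_eq0 => /eqP/esym.
Qed.

Lemma triangle_gallery (S : Type) (q : nat) (s t : S) (J : set S)
    (D : based_difference_set q) (x : Zdelta q) p :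
    J s -> J t -> List.Forall (fun e => e.2 \in (D : {set _})) p ->
    triangle_suite s t x p ->
  [/\ gtype p = alt s t (2 * 3), gallery (fun u _ _ => J u) x p
    & gend x p = x].
Proof.
move=> Js Jt Dp [-> [a [b [c [a' [b' [a0 ab bc e pE]]]]]]]; move: Dp; rewrite pE.
move=> /List.Forall_cons_iff[/= Da] /List.Forall_cons_iff[/= Db].
move=> /List.Forall_cons_iff[/= Dc] /List.Forall_cons_iff[/= Db'].
move=> /List.Forall_cons_iff[/= Da' _] {pE}.
have D0 := bds_based D.
have [_ [_ inj _]] := bds_diff D.
have uniqD (u v u' v' : Zdelta q) : u \in (D : {set _}) -> v \in (D : {set _}) ->
    u' \in (D : {set _}) -> v' \in (D : {set _}) -> u <> v ->
    u - v = u' - v' -> u = u' /\ v = v'.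
  move=> Du Dv Du' Dv' uv E.
  have u'v' : u' <> v'.
    by move=> h; apply: uv; apply/eqP; rewrite -subr_eq0 E h subrr.
  by have [] := inj (u, v) (u', v') (mem_set (And3 Du Dv uv))
    (mem_set (And3 Du' Dv' u'v')) E.
split => //=; split=> //; first exact/nesym.
split=> //; split=> //; split=> //.
  move=> h; move: e; rewrite -h [c - a']addrC => /addIr => e.
  by have [] := uniqD a b 0 a' Da Db D0 Da' ab; rewrite ?sub0r.
split=> //.
  move=> h; move: e; rewrite h subrr => e.
  have E : a - b = 0 - c by apply/eqP; rewrite sub0r -addr_eq0 -e.
  by have [] := uniqD a b 0 c Da Db D0 Dc ab E.
split=> // h; move: e; rewrite h subr0 => e.
have E : a - b = b' - c by rewrite e addrK.
by have [] := uniqD a b b' c Da Db Db' Dc ab E.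
Qed.

Lemma cox_neq (S : Type) (M : coxeter_matrix S) (s t : S) n :
  M s t = Some n -> n <> 1%N -> s <> t.
Proof. by move=> + n1 st; rewrite st cox_diag => -[]/esym. Qed.

Lemma digon_suiteP (S : Type) (M : coxeter_matrix S) (q : nat) (s t : S)
    (hst : M s t = Some 2%N) (u v : S) (x : Zk q) p :
    [/\ u = s, v = t & digon_suite s t x p] ->
  [/\ u <> v, exists2 m, M u v = Some m & gtype p = alt u v (2 * m),
      gallery (fun a _ _ => [set s; t] a) x p & gend x p = x].
Proof.
case=> -> -> sp; have Js : [set s; t] s by left.
have Jt : [set s; t] t by right.
have [*] := digon_gallery Js Jt sp.
by split=> //; [exact: cox_neq hst _|exists 2%N].
Qed.

Definition digon (S : Type) (M : coxeter_matrix S) (q : nat) (s t : S)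
    (hst : M s t = Some 2%N) : weyl_graph M [set s; t] :=
  @WeylGraph S M [set s; t] (Zk q)
    (fun u v x p => [/\ u = s, v = t & digon_suite s t x p])
    (digon_suiteP (q := q) hst).

Lemma gmap_gallery (S C C' : Type) (f : C -> C') (J : set S) (x : C) p n s t :
    injective f ->
    [/\ gtype (gmap f p) = alt s t n, gallery (fun u _ _ => J u) (f x) (gmap f p)
      & gend (f x) (gmap f p) = f x] ->
  [/\ gtype p = alt s t n, gallery (fun u _ _ => J u) x p & gend x p = x].
Proof.
move=> finj [tp gp ep]; split.
- by rewrite -tp /gtype /gmap -map_comp.
- elim: p x gp {tp ep} => [|[a y] p IH] x //= [Ja xy gp]; split=> //.
    by move=> h; apply: xy; rewrite h.
  exact: IH.
by apply: finj; rewrite -[RHS]ep /gend -(last_map f) -!map_comp.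
Qed.

Lemma triangle_suiteP (S : Type) (M : coxeter_matrix S) (q : nat)
    (D : based_difference_set q) (s t : S) (hst : M s t = Some 3%N)
    (u v : S) (x : {d : Zdelta q | d \in (D : {set _})}) p :
    [/\ u = s, v = t & triangle_suite s t (val x) (gmap val p)] ->
  [/\ u <> v, exists2 m, M u v = Some m & gtype p = alt u v (2 * m),
      gallery (fun a _ _ => [set s; t] a) x p & gend x p = x].
Proof.
case=> -> -> sp; have Js : [set s; t] s by left.
have Jt : [set s; t] t by right.
have Dp : List.Forall (fun e => e.2 \in (D : {set _})) (gmap val p).
  by elim: p {sp} => [|[a y] p IH] /=; constructor=> //=; apply: valP.
have [*] := gmap_gallery val_inj (triangle_gallery Js Jt Dp sp).
by split=> //; [exact: cox_neq hst _|exists 3%N].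
Qed.

Definition triangle (S : Type) (M : coxeter_matrix S) (q : nat)
    (D : based_difference_set q) (s t : S) (hst : M s t = Some 3%N) :
    weyl_graph M [set s; t] :=
  @WeylGraph S M [set s; t] {d : Zdelta q | d \in (D : {set _})}
    (fun u v x p =>
       [/\ u = s, v = t & triangle_suite s t (val x) (gmap val p)])
    (triangle_suiteP (D := D) hst).

Definition Cstar (q : nat) : set (Zk q) := [set x | x <> 0].
Arguments Cstar q : clear implicits.

(* The elements of D \ {0} as integers in {1, ..., delta - 1}. *)
Definition Dstar (q : nat) (D : {set Zdelta q}) : set nat :=
  [set n : nat | exists d : Zdelta q, [/\ d \in D, d <> 0 & n = d :> nat]].

(* Only the entries at (x, s, t) with x <> 0 and E s t are meaningful. *)
Record gluing_matrix (S : Type) (M : coxeter_matrix S) (E : S -> S -> Prop)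
    (q : nat) := GluingMatrix {
  gm_entry :> Zk q -> S -> S -> nat;
  gm_pos : forall (x : Zk q) s t, x <> 0 -> E s t -> (1 <= gm_entry x s t)%N;
  gm_digon : forall s t, E s t -> M s t = Some 2%N ->
    set_bij (Cstar q) [set n | 1 <= n <= q]%N (fun x => gm_entry x s t);
  gm_triangle : forall s t, E s t -> M s t = Some 3%N ->
    exists D : based_difference_set q,
      set_bij (Cstar q) (Dstar D) (fun x => gm_entry x s t) }.

(* Omega_st, for n + 1 = k or delta: then meaningful entries are at most n and
   [inZp] does not change them. *)
Definition Omega (S : Type) (q : nat) (A : Zk q -> S -> S -> nat) (n : nat)
    (s t : S) (x : Zk q) : 'I_n.+1 :=
  if x == 0 then 0 else inZp (A x s t).

Lemma Omega_inj (S : Type) (q : nat) (A : Zk q -> S -> S -> nat) (n : nat)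
    (s t : S) (B : set nat) :
  set_bij (Cstar q) B (fun x => A x s t) -> (forall b, B b -> 0 < b <= n)%N ->
  injective (@Omega S q A n s t).
Proof.
move=> [fB inj _] Bn.
have val_Omega x : x != 0 -> Omega A n s t x = A x s t :> nat.
  move=> x0; rewrite /Omega (negbTE x0) /= modn_small // ltnS.
  by have /andP[] := Bn _ (fB x (elimN eqP x0)).
have Omega_neq0 x : x != 0 -> Omega A n s t x != Omega A n s t 0.
  move=> x0; have /andP[+ _] := Bn _ (fB x (elimN eqP x0)).
  apply: contraTneq => /(congr1 (@nat_of_ord _)).
  by rewrite val_Omega // /Omega eqxx => ->.
move=> x y; have [->|x0] := eqVneq x 0; have [->|y0] := eqVneq y 0 => //.
- by move/esym/eqP => h; have := Omega_neq0 _ y0; rewrite h.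
- by move/eqP => h; have := Omega_neq0 _ x0; rewrite h.
move/(congr1 val); rewrite /= !val_Omega //.
by apply: inj; apply/mem_set; apply/eqP.
Qed.

(* The preimages under Omega_st of the suites of the triangle on D_st need no
   mention of D_st, which is the image of Omega_st. *)
Definition gluing_suite (S : Type) (M : coxeter_matrix S)
    (E : S -> S -> Prop) (q : nat) (A : gluing_matrix M E q)
    (s t : S) (x : Zk q) (p : seq (S * Zk q)) : Prop :=
  E s t /\
  ((M s t = Some 2%N /\
    digon_suite s t (Omega A q s t x) (gmap (Omega A q s t) p)) \/
   (M s t = Some 3%N /\
    triangle_suite s t (Omega A (q ^ 2 + q) s t x)
      (gmap (Omega A (q ^ 2 + q) s t) p))).

Lemma gluing_suiteP (S : Type) (M : coxeter_matrix S)
    (E : S -> S -> Prop) (q : nat) (A : gluing_matrix M E q)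
    (s t : S) (x : Zk q) p :
    gluing_suite A s t x p ->
  [/\ s <> t, exists2 m, M s t = Some m & gtype p = alt s t (2 * m),
      gallery (fun u _ _ => setT u) x p & gend x p = x].
Proof.
case=> Est [] [Mst sp].
  have [] := gmap_gallery (J := setT)
    (Omega_inj (gm_digon A Est Mst) _) (digon_gallery I I sp) => // *.
  by split=> //; [exact: cox_neq Mst _|exists 2%N].
have [D bijD] := gm_triangle A Est Mst.
have DP b : Dstar D b -> (0 < b <= q ^ 2 + q)%N.
  case=> d [_ d0 ->]; rewrite -[(d <= _)%N]ltnS ltn_ord andbT lt0n.
  by apply/eqP => h; apply: d0; apply: val_inj.
have OD y : Omega A (q ^ 2 + q) s t y \in (D : {set _}).
  rewrite /Omega; have [_|y0] := eqVneq y 0; first exact: bds_based.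
  have [fD _ _] := bijD; have [d [Dd _ ->]] := fD y (elimN eqP y0).
  by rewrite valZpK.
have FD : List.Forall (fun e => e.2 \in (D : {set _}))
    (gmap (Omega A (q ^ 2 + q) s t) p).
  by elim: p {sp} => [|[a y] p IH] /=; constructor=> //=; apply: OD.
have [] := gmap_gallery (J := setT)
  (Omega_inj bijD DP) (triangle_gallery I I FD sp) => // *.
by split=> //; [exact: cox_neq Mst _|exists 3%N].
Qed.

Definition weyl_of_gluing (S : Type) (M : coxeter_matrix S)
    (E : S -> S -> Prop) (q : nat) (A : gluing_matrix M E q) :
    weyl_graph M setT :=
  @WeylGraph S M setT (Zk q) (@gluing_suite S M E q A)
    (@gluing_suiteP S M E q A).

(* The bijection b identifies the chambers of the quotient with C. *)
Definition associated_gluing_matrix (S : Type) (M : coxeter_matrix S)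
    (X : chamber_system S) (G : aut_subgroup X) (hG : panel_regular G)
    (E : S -> S -> Prop) (q : nat) (A : gluing_matrix M E q) : Prop :=
  exists2 b : chamber (quotient_weyl_graph M hG) -> Zk q, bijective b &
    forall s t, E s t ->
      (forall hst : M s t = Some 2%N,
        exists f : Zk q -> chamber (digon q hst),
          [/\ bijective f, f 0 = 0 :> Zk q,
              weyl_iso (W := residue (quotient_weyl_graph M hG) s t) (f \o b)
            & forall x : Zk q, x <> 0 -> A x s t = f x :> nat]) /\
      (forall hst : M s t = Some 3%N,
        exists (D : based_difference_set q)
               (f : Zk q -> chamber (triangle D hst)),
          [/\ bijective f, val (f 0) = 0 :> Zdelta q,
              weyl_iso (W := residue (quotient_weyl_graph M hG) s t) (f \o b)
            & forall x : Zk q, x <> 0 -> A x s t = val (f x) :> nat]).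

(* Main.v *)
Require Import Defs.
From mathcomp Require Import all_boot all_order all_algebra.
From mathcomp Require Import boolp classical_sets functions cardinality.

(** The identification [b] of the chambers of the quotient with [Z/k] is itself
    an isomorphism. A chamber map carrying defining suites to null-homotopic
    galleries induces a map of fundamental groupoids, so it is enough to look at
    one pair of types [s, t] at a time. There [b] factors through the standard
    digon or triangle: the residue is isomorphic to it by the choice of the
    gluing matrix, and its suites are by construction the [Omega_st]-images of
    those of the glued graph. *)

Set Implicit Arguments.
Unset Strict Implicit.
Unset Printing Implicit Defensive.

Local Open Scope classical_set_scope.

Section Gmap.
Variables (S C C' C'' : Type).

Lemma gmap_comp (g : C' -> C'') (f : C -> C') (p : seq (S * C)) :
  gmap g (gmap f p) = gmap (g \o f) p.
Proof. by rewrite /gmap -map_comp. Qed.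

Lemma gmap_id (p : seq (S * C)) : gmap id p = p.
Proof. by elim: p => //= -[s x] p ->. Qed.

Lemma eq_gmap (f g : C -> C') (p : seq (S * C)) : f =1 g -> gmap f p = gmap g p.
Proof. by move=> fg; apply: eq_map => e; rewrite fg. Qed.

Lemma gmapK (f : C -> C') (g : C' -> C) :
  cancel f g -> cancel (@gmap S C C' f) (gmap g).
Proof. by move=> fK p; elim: p => //= -[s x] p ->; rewrite fK. Qed.

Lemma gtype_gmap (f : C -> C') (p : seq (S * C)) : gtype (gmap f p) = gtype p.
Proof. by rewrite /gtype /gmap -map_comp. Qed.

Lemma gend_gmap (f : C -> C') (x : C) (p : seq (S * C)) :
  gend (f x) (gmap f p) = f (gend x p).
Proof. by rewrite /gend -(last_map f) -!map_comp. Qed.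

Lemma gallery_gmap (f : C -> C') (J : set S) (x : C) (p : seq (S * C)) :
  injective f -> gallery (fun u _ _ => J u) x p ->
  gallery (fun u _ _ => J u) (f x) (gmap f p).
Proof.
move=> finj; elim: p x => [|[s y] p IH] x //= [Js xy gp]; split=> //.
  by move/finj.
exact: IH.
Qed.

End Gmap.

Section FundamentalGroupoid.
Variables (S : Type) (M : coxeter_matrix S).

(** Induction on the derivation. The panel relations survive any chamber map, injective or not,
    because words may contain identities; only the suites impose a condition. Letting [J] grow
    covers the inclusion of a residue as well. *)
Lemma fgroupoid_eq_map (J J' : set S) (W : weyl_graph M J)
    (W' : weyl_graph M J') (f : chamber W -> chamber W') :
    J `<=` J' ->
    (forall s t x p, suite s t x p -> fgroupoid_eq (f x) (gmap f p) [::]) ->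
  forall x p r, fgroupoid_eq x p r ->
    fgroupoid_eq (f x) (gmap f p) (gmap f r).
Proof.
move=> JJ' fsuite x p r; elim=> {x p r}.
- move=> x p Jp; apply: fg_refl; rewrite gtype_gmap.
  exact: List.Forall_impl Jp.
- by move=> x p p' _; apply: fg_symm.
- by move=> x p p' p'' _ + _; apply: fg_trans.
- move=> x p p' r r' _ IHp _ IHr; rewrite /gmap !map_cat.
  by apply: fg_cat => //; rewrite gend_gmap.
- by move=> x s Js; apply: fg_id; apply: JJ'.
- by move=> x y z s Js; apply: fg_comp; apply: JJ'.
- by move=> x p s t; apply: fsuite.
Qed.

Lemma weyl_iso_suite (J : set S) (W W' : weyl_graph M J)
    (w : chamber W -> chamber W') (x : chamber W) p :
    weyl_iso w -> wgallery x p ->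
  fgroupoid_eq x p [::] <-> fgroupoid_eq (w x) (gmap w p) [::].
Proof.
by move=> [_ w_homotopic] gp; split=> eq_p;
  have [] := w_homotopic x p x [::] gp I; [case|move=> _ []].
Qed.

Lemma wgallery_residue (W : weyl_graph M setT) (s t u v : S)
    (x : chamber W) p :
  [set s; t] u -> [set s; t] v -> suite u v x p ->
  wgallery (W := residue W s t) x p.
Proof. by move=> Ju Jv sp; have [_ _] := residue_suiteP (And3 Ju Jv sp). Qed.

Lemma residue_fgroupoid_eq (W : weyl_graph M setT) (s t : S)
    (x : chamber W) p r :
  fgroupoid_eq (W := residue W s t) x p r -> fgroupoid_eq x p r.
Proof.
move=> eq_pr; have := @fgroupoid_eq_map _ _ (residue W s t) W id.
move=> /(_ _ _ _ _ _ eq_pr); rewrite !gmap_id; apply=> // u v y p' [_ _ sp'].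
by rewrite gmap_id; apply: fg_suite sp'.
Qed.

(* An isomorphism of Weyl graphs can be tested on 2-residues, each compared
   with the target through a model V whose suites are those of the target. *)
Lemma weyl_iso_residues (E : S -> S -> Prop) (W W' : weyl_graph M setT)
    (b : chamber W -> chamber W') :
    bijective b ->
    (forall s t x p, suite (w := W) s t x p -> E s t \/ E t s) ->
    (forall s t x p, suite (w := W') s t x p -> E s t) ->
    (forall s t, E s t -> M s t <> None ->
      exists (V : weyl_graph M [set s; t]) (f : chamber W' -> chamber V),
      [/\ bijective f,
          weyl_iso (W := residue W s t) (f \o b),
          forall u v x p, suite u v (f x) (gmap f p) -> suite u v x p
        & forall x p, suite s t x p -> suite s t (f x) (gmap f p)]) ->
  weyl_iso b.
Proof.
move=> bbij WE W'E models.
have fwd s t x p : suite (w := W) s t x p ->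
    fgroupoid_eq (b x) (gmap b p) [::].
  move=> sp; have [st [m Mst _] _ _] := suiteP sp.
  (* A suite of [W] may start with either type of an edge, but [models] speaks of oriented edges
     only: [(u, v)] is the pair [s], [t] in the order given by [E]. *)
  have [u [v [Euv Muv us ut]]] : exists u v,
      [/\ E u v, M u v <> None, [set u; v] s & [set u; v] t].
    case: (WE _ _ _ _ sp) => Est; [exists s, t|exists t, s]; split=> //.
    - by rewrite Mst.
    - by left.
    - by right.
    - by rewrite cox_sym Mst.
    - by right.
    - by left.
  have [V [f [[g fK gK] iso_fb Vsuite _]]] := models u v Euv Muv.
  have sp' : suite (w := residue W u v) s t x p by split.
  (* The image in [V] need not be a suite, only null-homotopic: [f \o b] respects homotopy. *)
  have /(weyl_iso_suite iso_fb)[+ _] := wgallery_residue us ut sp.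
  move=> /(_ (fg_suite sp')); rewrite -gmap_comp /= => eq_fp.
  (* The inverse of [f] takes suites of [V] to suites of [W'], so null-homotopies in [V] descend to
     [W']. *)
  have gsuite u' v' y r : suite (w := V) u' v' y r ->
      fgroupoid_eq (g y) (gmap g r) [::].
    rewrite -{1}[y]gK -{1}[r](gmapK gK) => /Vsuite; exact: fg_suite.
  have := fgroupoid_eq_map (@subsetT _ _) gsuite eq_fp.
  by rewrite fK (gmapK fK).
have [b' bK b'K] := bbij.
have bwd s t x p : suite (w := W') s t x p ->
    fgroupoid_eq (b' x) (gmap b' p) [::].
  move=> sp; have [_ [m Mst _] _ _] := suiteP sp.
  have Est := W'E _ _ _ _ sp.
  have [|V [f [_ iso_fb _ W'suite]]] := models s t Est; first by rewrite Mst.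
  (* Since [f \o b] takes [gmap b' p] to the suite [gmap f p] of [V], it reflects the null-homotopy
     back to the residue of [W]. *)
  have sfp := W'suite _ _ sp.
  apply: residue_fgroupoid_eq; apply/(weyl_iso_suite iso_fb).
    apply: gallery_gmap; first exact: can_inj b'K.
    by apply: (@wgallery_residue W' s t s t) => //; [left|right].
  by rewrite -gmap_comp /= b'K (gmapK b'K); apply: fg_suite sfp.
split=> // x p y r _ _; split=> -[xy eq_pr]; split; first by rewrite xy.
- exact: (fgroupoid_eq_map (@subset_refl _ _) fwd).
- exact: can_inj bK _ _ xy.
have := fgroupoid_eq_map (@subset_refl _ _) bwd eq_pr.
by rewrite bK !(gmapK bK).
Qed.

End FundamentalGroupoid.

(** Away from 0 the entries are values of [f], hence at most [n], and [inZp] leaves them unchanged.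
    This recovers the chosen bijection from the gluing matrix. *)
Lemma OmegaE (S : Type) (q : nat) (A : Zk q -> S -> S -> nat) (n : nat)
    (s t : S) (f : Zk q -> 'I_n.+1) :
    f 0%R = 0%R -> (forall x, x <> 0%R -> A x s t = f x :> nat) ->
  Omega A n s t =1 f.
Proof.
move=> f0 Af x; rewrite /Omega; have [->|/eqP x0] := eqVneq x 0%R; first by [].
by rewrite Af // valZpK.
Qed.

Theorem theorem3p3 (S : Type) (M : coxeter_matrix S)
    (hM : forall s t : S, s <> t ->
      M s t = Some 2 \/ M s t = Some 3 \/ M s t = None)
    (hL : defining_graph_connected M)
    (Delta : chamber_system S) (hDelta : is_building M Delta)
    (hfin : locally_finite Delta)
    (q : nat) (hq : 2 <= q)
    (Gamma : aut_subgroup Delta) (hGamma : singer_cyclic_lattice M q Gamma)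
    (E : S -> S -> Prop) (hE : orientation M E)
    (A : gluing_matrix M E q)
    (hA : associated_gluing_matrix (sl_regular (scl_singer hGamma)) A) :
  exists omega :
    chamber (quotient_weyl_graph M (sl_regular (scl_singer hGamma))) ->
    chamber (weyl_of_gluing A),
    weyl_iso omega.
Proof.
have [Eedge Etotal _] := hE; have [b bbij bA] := hA.
exists b; apply: (@weyl_iso_residues S M E) => //.
- move=> s t x p sp; have [st [m Mst _] _ _] := suiteP sp.
  by apply: Etotal; split; rewrite ?Mst.
- by move=> s t x p [].
move=> s t Est Mst; have [digonA triangleA] := bA s t Est.
have [st _] := Eedge _ _ Est.
case: (hM s t st) => [hst|[hst|//]].
- have [f [fbij f0 iso_fb Af]] := digonA hst.
  have fE : Omega A q s t =1 f by exact: OmegaE.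
  exists (digon q hst), f; split=> //.
    move=> u v x p [-> -> sp]; split=> //; left; split=> //.
    by rewrite fE (eq_gmap _ fE).
  move=> x p [_ [[_ sp]|[]]]; last by rewrite hst.
  by split=> //; rewrite -fE -(eq_gmap _ fE).
- have [D [f [fbij f0 iso_fb Af]]] := triangleA hst.
  (* Here [f] lands in the subtype of elements of [D] and [Omega] in Z/delta; suites of [triangle]
     are tested after [val], which reconciles the two. *)
  have fE : Omega A (q ^ 2 + q) s t =1 val \o f by exact: OmegaE.
  exists (triangle D hst), f; split=> //.
    move=> u v x p [-> ->]; rewrite gmap_comp => sp; split=> //; right.
    by split=> //; rewrite fE (eq_gmap _ fE).
  move=> x p [_ [[]|[_ sp]]]; first by rewrite hst.
  by split=> //; rewrite gmap_comp -(eq_gmap _ fE) -[val (f x)]fE.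
Qed.
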